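(* Any single-generated involutive two-valued group is isomorphic to a coset two-valued group of the form $X^{\mathbf a}_C=C/\iota_{\mathbf a}$, where $C$ is a cyclic group (finite or infinite) and $\iota_{\mathbf a}\colon C\to C$, $\iota_{\mathbf a}(c)=c^{-1}$, is the antipodal involution. In particular, every such two-valued group is commutative.
   Context: For a set $X$, $\mathrm{Sym}^2(X)$ is the set of two-element multisets $[x,y]$ of elements of $X$. A two-valued group is a set $X$ with a map $*\colon X\times X\to \mathrm{Sym}^2(X)$, an element $e\in X$ and a map $x\mapsto x^{-1}$ such that: (associativity) $x*(y*z)=(x*y)*z$ as four-element multisets, where $x*[u,v]$ is the multiset union of $x*u$ and $x*v$, and similarly for $[u,v]*z$; (strong identity) $e*x=x*e=[x,x]$; (existence and uniqueness of inverse) $e$ belongs to each of $x*x^{-1}$ and $x^{-1}*x$, and if $e$ belongs to $x*y$ or to $y*x$ then $y=x^{-1}$. It is commutative if $x*y=y*x$ for all $x,y$, and involutive if $x^{-1}=x$ for all $x$. An isomorphism is a bijection $f$ such that $x*y=[z_1,z_2]$ implies $f(x)*f(y)=[f(z_1),f(z_2)]$. A two-valued group is single-generated if there is an element $x$ such that the smallest subset containing $e$ and $x$ and containing both elements of $a*b$ whenever it contains $a,b$ (and closed under inverses) is the whole two-valued group. Coset construction: if $G$ is a group and $\iota$ an automorphism of $G$ with $\iota^2=\mathrm{id}$, then $G/\iota$ denotes the set of orbits of $\iota$ with $\pi(g)*\pi(h)=[\pi(gh),\pi(g\iota(h))]$, identity $\pi(e)$ and inverse $\pi(g)^{-1}=\pi(g^{-1})$,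 where $\pi\colon G\to G/\iota$ is the projection. *)

(* Defs.v *)
From HB Require Import structures.
From mathcomp Require Import all_boot.
From mathcomp Require Import finmap multiset.
From mathcomp Require Import boolp classical_sets.

Set Implicit Arguments.
Unset Strict Implicit.
Unset Printing Implicit Defensive.

Local Open Scope quotient_scope.
Local Open Scope mset_scope.
Local Open Scope group_scope.

(** * Two-element multisets *)

Definition sym2 (X : choiceType) := {A : {mset X} | size A == 2}.

Lemma mset2_seq (X : choiceType) (x y : X) :
  [mset x; y] = seq_mset [:: x; y].
Proof.
apply/msetP => z; rewrite mset_seqE mset1DE msetnE /= !(eq_sym z).
by case: (y == z).
Qed.

Fact upair_subproof (X : choiceType) (x y : X) :
  size ([mset x; y] : {mset X}) == 2.
Proof. by rewrite mset2_seq (perm_size (perm_eq_seq_mset _)). Qed.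

Definition upair (X : choiceType) (x y : X) : sym2 X :=
  exist _ [mset x; y] (upair_subproof x y).

Lemma upairC (X : choiceType) (x y : X) : upair x y = upair y x.
Proof. by apply: val_inj => /=; apply/msetP => z; rewrite !msetE2 addnC. Qed.

Lemma upairP (X : choiceType) (s : sym2 X) : exists x y : X, s = upair x y.
Proof.
have := valP s; case E: (enum_mset (val s)) => [|x [|y [|? ?]]] // _.
by exists x, y; apply: val_inj; rewrite /= mset2_seq -E seq_mset_id.
Qed.

Lemma in_upair (X : choiceType) (z x y : X) :
  (z \in val (upair x y)) = (z == x) || (z == y).
Proof. by rewrite /= in_msetD !in_mset1. Qed.

(** * Two-valued groups *)

(** [lift_r op x [u, v]] is the multiset union of [op x u] and [op x v], and
    [lift_l op [u, v] z] that of [op u z] and [op v z]; see [lift_r_upair] and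
    [lift_l_upair]. *)
Definition lift_r (X : choiceType) (op : X -> X -> sym2 X) (x : X)
  (s : sym2 X) : {mset X} := \big[msetD/mset0]_(u <- val s) val (op x u).

Definition lift_l (X : choiceType) (op : X -> X -> sym2 X) (s : sym2 X)
  (z : X) : {mset X} := \big[msetD/mset0]_(u <- val s) val (op u z).

Lemma big_upair (X : choiceType) (F : X -> {mset X}) (x y : X) :
  \big[msetD/mset0]_(u <- val (upair x y)) F u = F x `+` F y.
Proof.
apply/msetP => z.
have H (s : seq X) : (\big[msetD/mset0]_(u <- s) F u) z = \sum_(u <- s) F u z.
  elim: s => [|a s IH]; first by rewrite !big_nil mset0E.
  by rewrite !big_cons msetE2 IH.
rewrite H msetE2 /= mset2_seq.
rewrite (perm_big _ (perm_eq_seq_mset _)) /=.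
by rewrite !big_cons big_nil addn0.
Qed.

Lemma lift_r_upair (X : choiceType) (op : X -> X -> sym2 X) (x u v : X) :
  lift_r op x (upair u v) = val (op x u) `+` val (op x v).
Proof. exact: big_upair. Qed.

Lemma lift_l_upair (X : choiceType) (op : X -> X -> sym2 X) (u v z : X) :
  lift_l op (upair u v) z = val (op u z) `+` val (op v z).
Proof. exact: big_upair. Qed.

Record twoValuedGroup := TwoValuedGroup {
  tv_sort :> choiceType;
  tv_mul : tv_sort -> tv_sort -> sym2 tv_sort;
  tv_one : tv_sort;
  tv_inv : tv_sort -> tv_sort;
  tv_mulA : forall x y z : tv_sort,
    lift_r tv_mul x (tv_mul y z) = lift_l tv_mul (tv_mul x y) z;
  tv_mul1 : forall x : tv_sort,
    tv_mul tv_one x = upair x x /\ tv_mul x tv_one = upair x x;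
  tv_mulV : forall x : tv_sort,
    tv_one \in val (tv_mul x (tv_inv x)) /\
    tv_one \in val (tv_mul (tv_inv x) x);
  tv_inv_uniq : forall x y : tv_sort,
    tv_one \in val (tv_mul x y) \/ tv_one \in val (tv_mul y x) ->
    y = tv_inv x
}.

Definition tv_commutative (X : twoValuedGroup) : Prop :=
  forall x y : X, tv_mul x y = tv_mul y x.

Definition tv_involutive (X : twoValuedGroup) : Prop :=
  forall x : X, tv_inv x = x.

Definition tv_iso (X Y : twoValuedGroup) (f : X -> Y) : Prop :=
  bijective f /\
  forall x y z1 z2 : X, tv_mul x y = upair z1 z2 ->
    tv_mul (f x) (f y) = upair (f z1) (f z2).

Definition tv_isomorphic (X Y : twoValuedGroup) : Prop :=
  exists f : X -> Y, tv_iso f.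

Definition tv_closed (X : twoValuedGroup) (S : set X) : Prop :=
  [/\ S (tv_one X),
      forall x : X, S x -> S (tv_inv x) &
      forall a b : X, S a -> S b ->
        forall z : X, z \in val (tv_mul a b) -> S z].

Definition tv_generated (X : twoValuedGroup) (x : X) : set X :=
  smallest (@tv_closed X) [set x]%classic.

Definition tv_single_generated (X : twoValuedGroup) : Prop :=
  exists x : X, tv_generated x = [set: X]%classic.

(** * The coset construction *)

Record involution (G : groupType) := Involution {
  invol_fun :> {multiplicative G -> G};
  involK : involutive invol_fun
}.

Lemma invol1 (G : groupType) (iota : involution G) : iota 1 = 1.
Proof. by apply: (@mulgI _ (iota 1)); rewrite -gmulfM !mulg1. Qed.

Lemma involV (G : groupType) (iota : involution G) (g : G) :
  iota g^-1 = (iota g)^-1.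
Proof. by apply/esym/mulg1_eq; rewrite -gmulfM mulgV invol1. Qed.

Section Coset.
Variables (G : groupType) (iota : involution G).

Definition same_orbit (g h : G) : bool := (h == g) || (h == iota g).

Fact same_orbit_equiv : equiv_class_of same_orbit.
Proof.
split=> [g|g h|h g k]; first by rewrite /same_orbit eqxx.
  by rewrite /same_orbit; apply/orP/orP => -[] /eqP->; rewrite ?involK eqxx; auto.
rewrite /same_orbit => /orP[]/eqP-> /orP[]/eqP->; rewrite ?involK eqxx ?orbT //.
Qed.

Canonical same_orbit_rel := EquivRelPack same_orbit_equiv.

Definition orbits := {eq_quot same_orbit_rel}.

HB.instance Definition _ := Choice.on orbits.

Definition orbit_proj (g : G) : orbits := \pi_orbits g.

Lemma orbit_projP (g h : G) :
  orbit_proj g = orbit_proj h <-> h = g \/ h = iota g.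
Proof.
split=> [/eqquotP /orP[]/eqP->|H]; [by left|by right|].
by apply/eqquotP; apply/orP; case: H => ->; rewrite eqxx; auto.
Qed.

Lemma orbit_projI (g : G) : orbit_proj (iota g) = orbit_proj g.
Proof. by apply/esym/orbit_projP; right. Qed.

Lemma orbit_projK (a : orbits) : orbit_proj (repr a) = a.
Proof. exact: reprK. Qed.

(** The multivalued product does not depend on the representatives; see
    [coset_mul_proj] and [coset_inv_proj]. *)
Definition coset_mul (a b : orbits) : sym2 orbits :=
  upair (orbit_proj (repr a * repr b)) (orbit_proj (repr a * iota (repr b))).

Definition coset_one : orbits := orbit_proj 1.

Definition coset_inv (a : orbits) : orbits := orbit_proj (repr a)^-1.

Lemma repr_proj (g : G) :
  repr (orbit_proj g) = g \/ repr (orbit_proj g) = iota g.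
Proof. by apply/orbit_projP; rewrite orbit_projK. Qed.

Lemma coset_mul_proj (g h : G) :
  coset_mul (orbit_proj g) (orbit_proj h) =
  upair (orbit_proj (g * h)) (orbit_proj (g * iota h)).
Proof.
have e1 : orbit_proj (iota g * h) = orbit_proj (g * iota h).
  by rewrite -orbit_projI gmulfM involK.
have e2 : orbit_proj (iota g * iota h) = orbit_proj (g * h).
  by rewrite -gmulfM orbit_projI.
rewrite /coset_mul; case: (repr_proj g) => ->; case: (repr_proj h) => ->;
  by rewrite ?involK ?e1 ?e2 // upairC.
Qed.

Lemma coset_inv_proj (g : G) : coset_inv (orbit_proj g) = orbit_proj g^-1.
Proof.
rewrite /coset_inv; case: (repr_proj g) => -> //.
by rewrite -involV orbit_projI.
Qed.

Lemma coset_ind (P : orbits -> Prop) :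
  (forall g, P (orbit_proj g)) -> forall a, P a.
Proof. by move=> H a; rewrite -(orbit_projK a). Qed.

Fact coset_mulA (a b c : orbits) :
  lift_r coset_mul a (coset_mul b c) = lift_l coset_mul (coset_mul a b) c.
Proof.
elim/coset_ind: a => x; elim/coset_ind: b => y; elim/coset_ind: c => z.
rewrite !coset_mul_proj lift_r_upair lift_l_upair !coset_mul_proj.
rewrite !gmulfM !involK !mulgA; apply/msetP => t; rewrite /= !msetE2.
by rewrite -!addnA; congr addn; rewrite addnC -addnA addnC -addnA.
Qed.

Fact coset_mul1 (a : orbits) :
  coset_mul coset_one a = upair a a /\ coset_mul a coset_one = upair a a.
Proof.
elim/coset_ind: a => x; rewrite !coset_mul_proj.
by rewrite invol1 !mul1g !mulg1 orbit_projI.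
Qed.

Fact coset_mulV (a : orbits) :
  coset_one \in val (coset_mul a (coset_inv a)) /\
  coset_one \in val (coset_mul (coset_inv a) a).
Proof.
elim/coset_ind: a => x; rewrite !coset_inv_proj !coset_mul_proj !in_upair.
by rewrite mulgV mulVg eqxx.
Qed.

Fact coset_inv_uniq (a b : orbits) :
  coset_one \in val (coset_mul a b) \/ coset_one \in val (coset_mul b a) ->
  b = coset_inv a.
Proof.
elim/coset_ind: a => x; elim/coset_ind: b => y.
rewrite coset_inv_proj !coset_mul_proj !in_upair.
have key g : coset_one == orbit_proj g -> g = 1.
  by move/eqP/orbit_projP => [|->] //; rewrite invol1.
case=> /orP[]/key /eqP; rewrite ?mulg_eq1.
- by move=> /eqP ->; rewrite invgK.
- by move=> /eqP ->; rewrite invgK orbit_projI.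
- by move=> /eqP ->.
- by move=> /eqP ->; rewrite -involV orbit_projI.
Qed.

Definition coset_group : twoValuedGroup :=
  TwoValuedGroup coset_mulA coset_mul1 coset_mulV coset_inv_uniq.

End Coset.

(** * Cyclic groups and the antipodal involution *)

Definition cyclic_group (C : groupType) : Prop :=
  exists g : C, forall x : C, exists n : nat, x = g ^+ n \/ x = g ^- n.

Lemma cyclic_group_mulgC (C : groupType) :
  cyclic_group C -> commutative (@mul C).
Proof.
move=> [g gP] x y; have cV n : commute g (g ^- n).
  by apply/commuteV/commuteX.
have cg z : commute g z.
  by have [n [->|->]] := gP z; [apply/commuteX|].
have [n [->|->]] := gP x; apply/commute_sym.
  by apply/commuteX/commute_sym.
by apply/commuteV/commuteX/commute_sym.
Qed.

Definition antipode (C : groupType) (cycC : cyclic_group C) (c : C) : C := c^-1.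

Fact antipode_is_multiplicative (C : groupType) (cycC : cyclic_group C) :
  {morph antipode cycC : x y / x * y}.
Proof. by move=> x y; rewrite /antipode invgM (cyclic_group_mulgC cycC). Qed.

HB.instance Definition _ (C : groupType) (cycC : cyclic_group C) :=
  isMultiplicative.Build C C (antipode cycC)
    (antipode_is_multiplicative cycC).

Fact antipodeK (C : groupType) (cycC : cyclic_group C) :
  involutive (antipode cycC).
Proof. exact: invgK. Qed.

Definition antipodal_involution (C : groupType) (cycC : cyclic_group C) :
  involution C := Involution (@antipodeK C cycC).

Definition antipodal_coset_group (C : groupType) (cycC : cyclic_group C) :
  twoValuedGroup := coset_group (antipodal_involution cycC).

(* Main.v *)
(** Put [x_0 = e], [x_1 = x] and let [x_(n+1)] be the element of [x * x_n]
    remaining after [x_(n-1)] is removed; involutivity makes "[z] belongs to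
    [x * y]" invariant under cyclic shifts of [x, y, z], which is why [x_(n-1)]
    belongs to [x * x_n].  With [x_(-n) = x_n], associativity and cancellation
    of multisets yield [x_a * x_b = [x_(a+b), x_(a-b)]] for all integers [a, b].
    Hence [{x_a}] is all of the two-valued group, [K = {a | x_a = e}] is a
    subgroup of the integers, and [x_a = x_b] iff [a = b] or [a = - b] modulo
    [K]; so the cyclic group is the quotient of the integers by [K]. *)
From HB Require Import structures.
Require Import Defs.
From mathcomp Require Import all_boot.
From mathcomp Require Import all_order all_algebra.
From mathcomp Require Import zify.
From mathcomp Require Import finmap multiset classical_sets.

Set Implicit Arguments.
Unset Strict Implicit.
Unset Printing Implicit Defensive.

Import Order.TTheory GRing.Theory Num.Theory.

Local Open Scope quotient_scope.
Local Open Scope mset_scope.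
Local Open Scope ring_scope.

(** * Unordered pairs: cancellation and the other member *)

Section UnorderedPairs.
Variable X : choiceType.
Implicit Types (x y z u v : X) (A B C : {mset X}).

Lemma msetDI A B C : A `+` B = A `+` C -> B = C.
Proof. exact: (can_inj (@msetDKB _ A)). Qed.

Lemma upairI x u v : upair x u = upair x v -> u = v.
Proof.
move=> /(congr1 val) /= /msetDI /msetP/(_ u).
by rewrite !msetnE eqxx; case: eqP.
Qed.

Lemma upair_eq x y u v :
  upair x y = upair u v -> (x = u /\ y = v) \/ (x = v /\ y = u).
Proof.
move=> e; have : x \in val (upair u v) by rewrite -e in_upair eqxx.
rewrite in_upair => /orP[] /eqP xE; move: e; rewrite xE.
  by move=> /upairI ->; left.
by rewrite (upairC u) => /upairI ->; right.
Qed.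

Lemma mem_upair (s : sym2 X) x : x \in val s -> exists y, s = upair x y.
Proof.
have [u [v ->]] := upairP s; rewrite in_upair => /orP[] /eqP->; first by exists v.
by exists u; rewrite upairC.
Qed.

(** Removing [x] leaves at least one element, so the default of [nth] is never returned; the value
    is meaningful when [x] belongs to [s]. *)
Definition complement (s : sym2 X) (x : X) : X :=
  nth x (enum_mset (val s `\ x)) 0.

Lemma complement_upair x y : complement (upair x y) x = y.
Proof.
rewrite /complement; set A := (_ `\ x).
have -> : A = [mset y] by apply/msetP => z; rewrite msetB1E mset1DE addKn.
by rewrite enum_msetn.
Qed.

Lemma complementK (s : sym2 X) x : x \in val s -> upair x (complement s x) = s.
Proof. by move=> /mem_upair[y ->]; rewrite complement_upair. Qed.

End UnorderedPairs.

(** * From a cosine-like parametrization by the integers to a coset group *)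

(* The hypothesis [fM] is the product-to-sum identity of the cosine. *)
Section CosineParametrization.
Variables (X : twoValuedGroup) (f : int -> X).
Hypothesis f0 : f 0 = tv_one X.
Hypothesis fM : forall a b, tv_mul (f a) (f b) = upair (f (a + b)) (f (a - b)).

Lemma cosineN a : f (- a) = f a.
Proof.
have := fM 0 a; rewrite f0 (tv_mul1 _).1 add0r sub0r.
by move=> /upairI.
Qed.

Lemma cosine_commutes a b : tv_mul (f a) (f b) = tv_mul (f b) (f a).
Proof. by rewrite !fM addrC -(cosineN (a - b)) opprB. Qed.

(** By involutivity, two elements are equal exactly when [e] occurs in their product. *)
Lemma cosine_eq a b (Xinv : tv_involutive X) :
  f a = f b <-> f (a - b) = tv_one X \/ f (a + b) = tv_one X.
Proof.
split=> [e|e].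
  have := (tv_mulV (f a)).1; rewrite Xinv {2}e fM in_upair.
  by case/orP=> /eqP; auto.
rewrite -(Xinv (f a)); apply/esym/tv_inv_uniq; left.
by rewrite fM in_upair; case: e => ->; rewrite eqxx ?orbT.
Qed.

Definition period : {pred int} := [pred a | f a == tv_one X].

Lemma period_zmod_closed : zmod_closed period.
Proof.
split=> [|a b]; rewrite !inE ?f0 // => /eqP fa /eqP fb.
have := fM a b; rewrite fa fb (tv_mul1 _).1 => e.
have : f (a - b) \in val (upair (tv_one X) (tv_one X)).
  by rewrite e in_upair eqxx orbT.
by rewrite in_upair orbb.
Qed.

HB.instance Definition _ := GRing.isZmodClosed.Build int period period_zmod_closed.

(** The additive quotient of the integers by the periods, in the multiplicative notation of the
    coset construction. *)
Definition period_quotient : groupType :=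
  Algebra.to_multiplicative (Quotient.quot period).

Definition residue (a : int) : period_quotient := \pi_(Quotient.quot period) a.

Lemma residueD a b : residue (a + b) = (residue a * residue b)%g.
Proof. exact: (raddfD (\pi_(Quotient.quot period))). Qed.

Lemma residueN a : residue (- a) = (residue a)^-1%g.
Proof. exact: (raddfN (\pi_(Quotient.quot period))). Qed.

Lemma residue_eq a b : residue a = residue b <-> f (a - b) = tv_one X.
Proof.
rewrite /residue; split=> [/eqP|/eqP e].
  by rewrite -Quotient.idealrBE inE => /eqP.
by apply/eqP; rewrite -Quotient.idealrBE inE.
Qed.

Lemma residue_surj (c : period_quotient) : exists a, residue a = c.
Proof. by exists (repr (c : Quotient.quot period)); apply: reprK. Qed.

Lemma residueX (n : nat) : residue n%:Z = (residue 1%:Z ^+ n)%g.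
Proof.
elim: n => [|n IH]; first by rewrite expg0; apply: (raddf0 (\pi_(Quotient.quot period))).
by rewrite expgS -IH -residueD -intS.
Qed.

Lemma period_quotient_cyclic : cyclic_group period_quotient.
Proof.
exists (residue 1) => c; have [a <-] := residue_surj c.
case: (intP a) => [|n|n]; first by exists 0%N; left; rewrite residueX.
  by exists n.+1; left; rewrite residueX.
by exists n.+1; right; rewrite residueN residueX.
Qed.

Let Y := antipodal_coset_group period_quotient_cyclic.

Definition residue_orbit (a : int) : Y :=
  orbit_proj (antipodal_involution period_quotient_cyclic) (residue a).

Lemma residue_orbit_surj (y : Y) : exists a, residue_orbit a = y.
Proof.
elim/coset_ind: y => c; have [a <-] := residue_surj c.
by exists a.
Qed.

Lemma residue_orbit_eq a b (Xinv : tv_involutive X) :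
  residue_orbit a = residue_orbit b <-> f a = f b.
Proof.
rewrite cosine_eq // orbit_projP /= /antipode -residueN.
split=> [[/esym/residue_eq|/esym/residue_eq]|[/residue_eq->|]].
- by left.
- by rewrite -opprD cosineN; right.
- by left.
- by move=> ab; right; apply/esym/residue_eq; rewrite -opprD cosineN.
Qed.

Lemma residue_orbitM a b :
  tv_mul (residue_orbit a) (residue_orbit b) =
  upair (residue_orbit (a + b)) (residue_orbit (a - b)).
Proof.
by rewrite /= coset_mul_proj /residue_orbit !residueD residueN.
Qed.

Lemma cosine_isomorphic (Xinv : tv_involutive X) :
  (forall x, exists a, f a = x) -> tv_isomorphic X Y.
Proof.
move=> fsurj.
have fsurjb x : exists a, f a == x by have [a <-] := fsurj x; exists a.
(* [log x] is an arbitrary preimage; by [logE] its orbit does not depend on the choice. *)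
pose log x := xchoose (fsurjb x).
have logK x : f (log x) = x by apply/eqP/(xchooseP (fsurjb x)).
have logE a : residue_orbit (log (f a)) = residue_orbit a.
  by apply/residue_orbit_eq.
have qsurjb y : exists a, residue_orbit a == y.
  by have [a <-] := residue_orbit_surj y; exists a.
have phiM a b : tv_mul (residue_orbit (log (f a))) (residue_orbit (log (f b))) =
    upair (residue_orbit (log (f (a + b)))) (residue_orbit (log (f (a - b)))).
  by rewrite !logE residue_orbitM.
exists (fun x => residue_orbit (log x)); split.
  exists (fun y => f (xchoose (qsurjb y))) => [x|y].
    rewrite -[RHS]logK; apply/residue_orbit_eq => //.
    exact/eqP/(xchooseP (qsurjb _)).
  rewrite logE; exact/eqP/(xchooseP (qsurjb _)).
move=> x y z1 z2; rewrite -(logK x) -(logK y) phiM fM.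
by move=> /upair_eq[] [-> ->] //; rewrite upairC.
Qed.

End CosineParametrization.

(** * Powers of an element of an involutive two-valued group *)

Section Involutive.
Variable X : twoValuedGroup.
Hypothesis Xinv : tv_involutive X.
Implicit Types x y z : X.

Lemma mem_one_mul x y : (tv_one X \in val (tv_mul x y)) = (x == y).
Proof.
apply/idP/eqP => [e|->]; first by rewrite -(Xinv x); apply/esym/tv_inv_uniq; left.
by rewrite -{1}(Xinv y); apply: (tv_mulV y).2.
Qed.

(* Both sides say that [e] occurs in the associative triple product of
   [x], [y], [z]. *)
Lemma mem_mul_rot x y z : (x \in val (tv_mul y z)) = (z \in val (tv_mul x y)).
Proof.
have := tv_mulA x y z.
have [u [v eyz]] := upairP (tv_mul y z); have [u' [v' exy]] := upairP (tv_mul x y).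
rewrite eyz exy lift_r_upair lift_l_upair !in_upair => /msetP/(_ (tv_one X)).
move=> /(congr1 (leq 1)); rewrite -!in_mset !in_msetD !mem_one_mul.
by rewrite !(eq_sym z).
Qed.

Section Powers.
Variable x : X.

(* The state is [(x_(n-1), x_n)]; since [x * e = [x, x]], the starting value
   [x_(-1) = x] is forced. *)
Definition power_step (p : X * X) : X * X :=
  (p.2, complement (tv_mul x p.2) p.1).

Definition power_pair (n : nat) : X * X := iter n power_step (x, tv_one X).

Definition power (n : nat) : X := (power_pair n).2.

(** The membership makes [complement] meaningful at the next step; its proof needs commutation with
    [x], which is therefore carried along. *)
Lemma power_pair_invariant n : let p := power_pair n in
  [/\ tv_mul x p.1 = tv_mul p.1 x, tv_mul x p.2 = tv_mul p.2 x &
      p.1 \in val (tv_mul x p.2)].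
Proof.
elim: n => [|n] /=; first by rewrite (tv_mul1 x).1 (tv_mul1 x).2 in_upair eqxx.
rewrite /power_step; case: (power_pair n) => u w /= [xu xw uxw].
have e := complementK uxw; set v := complement _ _ in e *.
have xv : tv_mul x v = tv_mul v x.
  apply: val_inj; apply: (@msetDI _ (val (tv_mul x u))).
  rewrite -[LHS](lift_r_upair (@tv_mul X)) e {1}xw tv_mulA -e lift_l_upair.
  by rewrite xu.
by split=> //; rewrite xv -mem_mul_rot -e in_upair eqxx orbT.
Qed.

Definition power_int (a : int) : X := power `|a|%N.

Lemma power_intN a : power_int (- a) = power_int a.
Proof. by rewrite /power_int abszN. Qed.

Lemma power_int1 : power_int 1 = x.
Proof.
rewrite /power_int /power /= (tv_mul1 x).2.
exact: complement_upair.
Qed.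

Lemma power_succ (n : nat) :
  tv_mul x (power n.+1) = upair (power n.+2) (power n).
Proof.
have [_ _ /complementK <-] := power_pair_invariant n.+1.
exact: upairC.
Qed.

Lemma power_int1M a :
  tv_mul x (power_int a) = upair (power_int (a + 1)) (power_int (a - 1)).
Proof.
wlog: a / 0 <= a => [H|].
  case: (lerP 0 a) => [/H//|a_lt0].
  rewrite -(power_intN a) H ?oppr_ge0 ?ltW // upairC.
  by rewrite -opprD power_intN (addrC (- a)) -(opprB 1) power_intN.
case: a => // -[|n] _.
  by rewrite add0r sub0r power_intN power_int1 /power_int (tv_mul1 x).2.
rewrite {1}/power_int power_succ; congr (upair (power _) (power _)); lia.
Qed.

Lemma power_intM a b :
  tv_mul (power_int a) (power_int b) =
  upair (power_int (a + b)) (power_int (a - b)).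
Proof.
wlog: a / 0 <= a => [H|].
  case: (lerP 0 a) => [/H//|a_lt0].
  rewrite -(power_intN a) H ?oppr_ge0 ?ltW // upairC.
  by rewrite -opprD power_intN (addrC (- a)) -(opprB b) power_intN.
case: a => // n _; elim/ltn_ind: n b => -[|[|n]] IH b.
- by rewrite add0r sub0r power_intN /power_int (tv_mul1 _).1.
- by rewrite power_int1 power_int1M addrC -opprB power_intN.
(* Both sides of [x * (x_(n+1) * x_b) = (x * x_(n+1)) * x_b] contain [[x_(n+b), x_(n-b)]], on the
   right as [x_n * x_b]; cancelling it leaves the claim for [n + 2]. *)
have := tv_mulA x (power_int n.+1) (power_int b).
rewrite power_succ IH // lift_r_upair lift_l_upair !power_int1M.
rewrite (IH n) // -/(power_int n.+2).
have -> : n.+1%:Z + b + 1 = n.+2%:Z + b by lia.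
have -> : n.+1%:Z + b - 1 = n%:Z + b by lia.
have -> : n.+1%:Z - b + 1 = n.+2%:Z - b by lia.
have -> : n.+1%:Z - b - 1 = n%:Z - b by lia.
move=> /msetP e; apply/esym/val_inj/msetP => z.
by move: (e z); rewrite /= !msetE2; lia.
Qed.

(** The powers form a closed set containing [x]: inversion is trivial and [power_intM] handles
    products. *)
Lemma power_generated (y : X) : tv_generated x y -> exists a, power_int a = y.
Proof.
apply: (@smallest_sub _ _ _ [set z | exists a, power_int a = z]%classic); last first.
  by move=> _ ->; exists 1; apply: power_int1.
split; first by exists 0.
  by move=> z; rewrite Xinv.
move=> _ _ [a <-] [b <-] z; rewrite power_intM in_upair.
by case/orP=> /eqP ->; eexists.
Qed.

End Powers.
End Involutive.

Theorem theorem2p1 (X : twoValuedGroup) (Xsg : tv_single_generated X)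
    (Xinv : tv_involutive X) :
  (exists (C : groupType) (cycC : cyclic_group C),
     tv_isomorphic X (antipodal_coset_group cycC)) /\
  tv_commutative X.
Proof.
have [x genX] := Xsg.
have fsurj y : exists a, power_int x a = y.
  by apply: (power_generated Xinv); rewrite genX.
have fM := power_intM Xinv x; split; last first.
  move=> y z; have [a <-] := fsurj y; have [b <-] := fsurj z.
  exact: (cosine_commutes (erefl : power_int x 0 = tv_one X) fM).
(* [erefl] proves [x_0 = e], which holds by computation. *)
exists (period_quotient erefl fM), (period_quotient_cyclic erefl fM).
exact: cosine_isomorphic.
Qed.
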